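(* Let $a<b$ be real numbers, let $m>0$ be real and let $\sigma\in\mathcal{A}(m)$. Let $f_0:[a,b]\to(\mathbb{E}^1,D_E)$ be continuous, where $D_E$ is the endograph metric. Then, for every $n\in\mathbb{N}$, $n\geq 1$, $$\sup_{x\in[a,b]} D_E\big(S_{n,\sigma}(f_0,x), f_0(x)\big)\leq\sqrt{2}\cdot\omega^{\mathcal{F}}_{D_E}\Big(f_0,\frac{b-a}{n}\Big).$$
   Context: Fuzzy numbers: for $u:\mathbb{R}\to[0,1]$ put $[u]^{\lambda}=\{x\in\mathbb{R}: u(x)\ge\lambda\}$ for $\lambda\in(0,1]$ and $[u]^0=\overline{\{x\in\mathbb{R}: u(x)>0\}}$. A fuzzy number is a function $u:\mathbb{R}\to[0,1]$ such that: there is $x$ with $u(x)=1$; $u$ is upper semicontinuous; $u(\alpha x+(1-\alpha)y)\ge\min\{u(x),u(y)\}$ for all $x,y\in\mathbb{R}$, $\alpha\in[0,1]$; and $[u]^0$ is compact. $\mathbb{E}^1$ is the set of fuzzy numbers. Arithmetic: for $u,v\in\mathbb{E}^1$ and $c\in\mathbb{R}$, $u+v$ and $cu$ are the fuzzy numbers determined levelwise by $[u+v]^\lambda=[u]^\lambda+[v]^\lambda$ (Minkowski sum) and $[cu]^\lambda=c[u]^\lambda$, $\lambda\in[0,1]$. Class $\mathcal{A}(m)$: for real $m>0$, $\sigma\in\mathcal{A}(m)$ means $\sigma:\mathbb{R}\to\mathbb{R}$ is nondecreasing with $\sigma(x)=0$ for $x\le -m$ and $\sigma(x)=1$ for $x\ge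 m$. Put $\varphi(x)=\sigma(x+m)-\sigma(x-m)$. Operator: for $f:[a,b]\to\mathbb{E}^1$, $x\in[a,b]$ and $n\ge1$, $$S_{n,\sigma}(f,x)=\sum_{k=0}^{n}\varphi\Big(\frac{2m}{h}(x-x_k)\Big)f(x_k),\qquad h=\frac{b-a}{n},\quad x_k=a+kh.$$ Endograph metric: $\mathrm{end}(u)=\{(x,\beta)\in\mathbb{R}\times[0,1]: u(x)\ge\beta\}$, a closed set, and $D_E(u,v)=d_H(\mathrm{end}(u),\mathrm{end}(v))$, where $d_H(A,B)=\max\{\sup_{p\in A}\inf_{q\in B}d(p,q),\ \sup_{q\in B}\inf_{p\in A}d(p,q)\}$ is the Hausdorff distance in $\mathbb{R}\times[0,1]$ with the Euclidean metric $d$. Fuzzy modulus of continuity: $\omega^{\mathcal{F}}_{D_E}(f,\delta)=\sup\{D_E(f(x),f(y)): x,y\in[a,b],\ |x-y|<\delta\}$. *)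

(* Defs.v *)
From HB Require Import structures.
From mathcomp Require Import all_boot all_order all_algebra.
From mathcomp Require Import all_classical all_reals all_analysis.
From mathcomp Require Import ring lra.

Set Implicit Arguments.
Unset Strict Implicit.
Unset Printing Implicit Defensive.

Import Order.TTheory GRing.Theory Num.Theory.
Import numFieldNormedType.Exports.

Local Open Scope classical_set_scope.
Local Open Scope ring_scope.

Section fuzzy_numbers.
Context {R : realType}.
Implicit Types (u v : R -> R) (l c x y z : R).

(* Mirrors [lower_semicontinuous], which the library states for \bar R. *)
Definition upper_semicontinuous u :=
  forall x l, u x < l -> \forall y \near x, u y < l.

(* Meaningful for 0 <= l <= 1. *)
Definition level u l : set R :=
  if l == 0 then closure [set x | 0 < u x] else [set x | l <= u x].

Record is_fuzzy_number u : Prop := IsFuzzyNumber {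
  fuzzy_ge0_le1 : forall x, 0 <= u x <= 1 ;
  fuzzy_normal : exists x, u x = 1 ;
  fuzzy_usc : upper_semicontinuous u ;
  fuzzy_convex : forall x y l, 0 <= l <= 1 ->
    Num.min (u x) (u y) <= u (l * x + (1 - l) * y) ;
  fuzzy_compact : compact (level u 0) }.

End fuzzy_numbers.

Record fuzzy_number (R : realType) := FuzzyNumber {
  membership :> R -> R ;
  fuzzy_numberP : is_fuzzy_number membership }.

Lemma fuzzy_ext (R : realType) (u v : fuzzy_number R) : u =1 v -> u = v.
Proof.
case: u v => u up [v vp] /= /funext uv; case: _ / uv vp => vp.
by rewrite (Prop_irrelevance up vp).
Qed.

HB.instance Definition _ (R : realType) := gen_eqMixin (fuzzy_number R).
HB.instance Definition _ (R : realType) := gen_choiceMixin (fuzzy_number R).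

Section levels.
Context {R : realType}.
Implicit Types (u v w : fuzzy_number R) (l c x y z : R).

Lemma fuzzy_ge0 u x : 0 <= u x.
Proof. by case/andP: (fuzzy_ge0_le1 (fuzzy_numberP u) x). Qed.

Lemma fuzzy_le1 u x : u x <= 1.
Proof. by case/andP: (fuzzy_ge0_le1 (fuzzy_numberP u) x). Qed.

Lemma level_inj u v :
  (forall l, 0 <= l <= 1 -> level u l = level v l) -> u = v.
Proof.
move=> uv; suff H (u1 v1 : fuzzy_number R) x :
    (forall l, 0 <= l <= 1 -> level u1 l = level v1 l) -> u1 x <= v1 x.
  apply: fuzzy_ext => x; apply/eqP; rewrite eq_le !H// => l l01.
  by rewrite uv.
move=> /(_ (u1 x) (fuzzy_ge0_le1 (fuzzy_numberP u1) x)); rewrite /level.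
case: eqVneq => [-> _|_ /seteqP[+ _]]; first exact: fuzzy_ge0.
by move=> /(_ x); apply => /=.
Qed.

Lemma level_pos (u : R -> R) l : 0 < l -> level u l = [set x | l <= u x].
Proof. by rewrite /level => l0; rewrite gt_eqF. Qed.

Lemma usc_superlevel (u : R -> R) : (forall x, 0 <= u x) ->
  (forall l, 0 < l -> closed [set x | l <= u x]) -> upper_semicontinuous u.
Proof.
move=> u0 ucl x l ul; have l0 : 0 < l by exact: le_lt_trans (u0 x) ul.
have /closed_openC oC := ucl _ l0.
have : nbhs x (~` [set x | l <= u x]).
  by apply: open_nbhs_nbhs; split => //=; apply/negP; rewrite -ltNge.
by apply: filterS => y /= /negP; rewrite -ltNge.
Qed.

Lemma superlevel_closed (u : R -> R) l :
  upper_semicontinuous u -> closed [set x | l <= u x].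
Proof.
move=> usc; rewrite -[X in closed X]setCK; apply: open_closedC.
rewrite openE => x /= /negP; rewrite -ltNge => /usc.
by apply: filterS => y /= yl; apply/negP; rewrite -ltNge.
Qed.

Lemma superlevel_compact u l : 0 < l -> compact [set x | l <= u x].
Proof.
move=> l0; apply: (subclosed_compact _ (fuzzy_compact (fuzzy_numberP u))).
  exact: superlevel_closed (fuzzy_usc (fuzzy_numberP u)).
rewrite /level eqxx => x /= lu; apply: subset_closure => /=.
exact: lt_le_trans lu.
Qed.

Lemma level_compact u l : 0 <= l -> compact (level u l).
Proof.
rewrite le_eqVlt => /predU1P[<-|l0]; first exact: fuzzy_compact (fuzzy_numberP u).
by rewrite level_pos//; exact: superlevel_compact.
Qed.

Let compactR_closed (A : set R) : compact A -> closed A.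
Proof. by move=> cA; exact: (compact_closed (@Rhausdorff R) cA). Qed.

Let compactR_closure (A : set R) : compact A -> closure A = A.
Proof. by move=> /compactR_closed/closure_id. Qed.

Let closed_preimage (g : R -> R) (A : set R) :
  continuous g -> closed A -> closed (g @^-1` A).
Proof. by move=> cg cA; exact: (preimage_closed (fun x _ => cg x) cA). Qed.

Lemma usc_compact_max (K : set R) (g : R -> R) : compact K -> K !=set0 ->
  upper_semicontinuous g -> exists2 p, K p & forall x, K x -> g x <= g p.
Proof.
move=> cK [x0 Kx0] ug.
pose F := filter_from K (fun x => [set y | K y /\ g x <= g y]).
have FF : ProperFilter F.
  apply: filter_from_proper; last by move=> x Kx; exists x => /=.
  apply: filter_from_filter; first by exists x0.
  move=> x y Kx Ky; have [xy|yx] := leP (g x) (g y).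
    by exists y => // z /= [Kz yz]; split; split => //; exact: le_trans yz.
  exists x => // z /= [Kz xz]; split; split => //.
  exact: le_trans (ltW yx) xz.
have FK : F K by exists x0 => // y [].
have [p [Kp cp]] := cK F FF FK.
exists p => // x Kx; rewrite leNgt; apply/negP => /ug pV.
have Fx : F [set y | K y /\ g x <= g y] by exists x.
by have [y [[_ +] /=]] := cp _ _ Fx pV; rewrite leNgt => /negP.
Qed.

Definition minkowski_sum (A B : set R) : set R := [set x + y | x in A & y in B].

Lemma minkowski_compact (A B : set R) :
  compact A -> compact B -> compact (minkowski_sum A B).
Proof.
move=> cA cB; rewrite /minkowski_sum image2E.
have -> : uncurry +%R = (fun p : R * R => p.1 + p.2).
  by apply/funext => -[].
apply: continuous_compact; last exact: compact_setX.
apply: continuous_subspaceT => p.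
by apply: cvgD; [exact: cvg_fst|exact: cvg_snd].
Qed.

Lemma fuzzy_add_exists u v : exists w : fuzzy_number R,
  forall l, 0 <= l <= 1 -> level w l = minkowski_sum (level u l) (level v l).
Proof.
pose g z x := Num.min (u x) (v (z - x)).
have gmax z : exists p, forall x, g z x <= g z p.
  have [||p _ pmax] := @usc_compact_max (level u 0) (g z)
      (fuzzy_compact (fuzzy_numberP u)).
  - have [x ux] := fuzzy_normal (fuzzy_numberP u).
    exists x; rewrite /level eqxx; apply: subset_closure => /=.
    by rewrite ux.
  - apply: usc_superlevel => [x|l l0].
      by rewrite le_min !fuzzy_ge0.
    have -> : [set x | l <= g z x] =
        [set x | l <= u x] `&` (fun x => z - x) @^-1` [set x | l <= v x].
      by apply/seteqP; split => x /=; rewrite /g le_min => /andP.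
    apply: closedI.
      exact: superlevel_closed (fuzzy_usc (fuzzy_numberP u)).
    apply: closed_preimage.
      by move=> x; apply: cvgB; [exact: cvg_cst|exact: cvg_id].
    exact: superlevel_closed (fuzzy_usc (fuzzy_numberP v)).
  exists p => x; have [ux0|ux0] := leP (u x) 0.
    apply: (@le_trans _ _ 0); first by rewrite ge_min ux0.
    by rewrite le_min !fuzzy_ge0.
  by apply: pmax; rewrite /level eqxx; exact: subset_closure.
have /choice[p pmax] := gmax.
pose w z := g z (p z).
have w0 z : 0 <= w z by rewrite le_min !fuzzy_ge0.
have wpos l : 0 < l -> [set z | l <= w z] =
    minkowski_sum [set x | l <= u x] [set y | l <= v y].
  move=> l0; apply/seteqP; split => z /=.
    rewrite /w le_min => /andP[lu lv]; exists (p z) => //.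
    by exists (z - p z) => //; rewrite addrC subrK.
  move=> [x lu [y lv <-]]; apply: le_trans (pmax _ x).
  by rewrite le_min [_ + y]addrC addrK; apply/andP; split.
have wlev0 : level w 0 = minkowski_sum (level u 0) (level v 0).
  rewrite /level eqxx; apply/seteqP; split.
    have -> : minkowski_sum (closure [set x | 0 < u x])
        (closure [set x | 0 < v x]) =
        closure (minkowski_sum (closure [set x | 0 < u x])
          (closure [set x | 0 < v x])).
      apply/esym/compactR_closure.
      have := fuzzy_compact (fuzzy_numberP v).
      have := fuzzy_compact (fuzzy_numberP u).
      by rewrite /level eqxx; exact: minkowski_compact.
    apply/closureS => z /= wz.
    have : [set y | w z <= w y] z by exact: lexx.
    rewrite (wpos _ wz) => -[x xu [y yv xy]].
    exists x; first by apply: subset_closure; apply: lt_le_trans wz xu.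
    by exists y => //; apply: subset_closure; apply: lt_le_trans wz yv.
  move=> _ [x xu [y yv <-]] B.
  rewrite -nbhs_ballE => -[e /= e0 eB].
  have e20 : 0 < e / 2 by rewrite divr_gt0.
  have [x' [/= ux' xx']] := xu _ (nbhsx_ballx x _ e20).
  have [y' [/= vy' yy']] := yv _ (nbhsx_ballx y _ e20).
  exists (x' + y'); split => /=.
    apply: lt_le_trans (pmax _ x').
    by rewrite lt_min [_ + y']addrC addrK ux' vy'.
  apply: eB; move: xx' yy'; rewrite /ball /= => xx' yy'.
  rewrite opprD addrACA (le_lt_trans (ler_normD _ _))//.
  by rewrite [ltRHS]splitr ltrD.
have wF : is_fuzzy_number w.
  split.
  - by move=> z; rewrite w0 ge_min fuzzy_le1.
  - have [x ux] := fuzzy_normal (fuzzy_numberP u).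
    have [y vy] := fuzzy_normal (fuzzy_numberP v).
    exists (x + y); apply/eqP; rewrite eq_le ge_min fuzzy_le1/=.
    apply: le_trans (pmax _ x).
    by rewrite le_min ux [_ + y]addrC addrK vy lexx.
  - apply: usc_superlevel => // l l0; rewrite (wpos _ l0).
    apply: compactR_closed.
    by apply: minkowski_compact; exact: superlevel_compact.
  - move=> x y l l01.
    apply: le_trans (pmax _ (l * p x + (1 - l) * p y)).
    have -> : g (l * x + (1 - l) * y) (l * p x + (1 - l) * p y) =
      Num.min (u (l * p x + (1 - l) * p y))
        (v (l * (x - p x) + (1 - l) * (y - p y))).
      by congr (Num.min _ (v _)); rewrite !mulrBr opprD addrACA.
    have := fuzzy_convex (fuzzy_numberP u) (p x) (p y) l01.
    have := fuzzy_convex (fuzzy_numberP v) (x - p x) (y - p y) l01.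
    move=> hv hu; rewrite le_min; apply/andP; split.
      apply: le_trans hu; rewrite /w /g !le_min.
      by rewrite !ge_min !lexx !orbT.
    apply: le_trans hv; rewrite /w /g !le_min.
    by rewrite !ge_min !lexx !orbT.
  - rewrite wlev0; apply: minkowski_compact;
    exact: fuzzy_compact (fuzzy_numberP _).
exists (FuzzyNumber wF) => l /andP[+ _].
rewrite le_eqVlt => /predU1P[<-//|l0] /=.
by rewrite !level_pos// wpos.
Qed.

(* The fuzzy number with these levels is unique by [level_inj]. *)
Definition fuzzy_add u v : fuzzy_number R := sval (cid (fuzzy_add_exists u v)).

Lemma level_add u v l : 0 <= l <= 1 ->
  level (fuzzy_add u v) l = minkowski_sum (level u l) (level v l).
Proof. by move=> l01; rewrite /fuzzy_add; case: cid => w /= ->. Qed.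

Lemma level_nonempty u l : 0 <= l <= 1 -> level u l !=set0.
Proof.
move=> /andP[l0 l1]; have [x ux] := fuzzy_normal (fuzzy_numberP u); exists x.
rewrite /level; case: ifPn => _ /=; last by rewrite ux.
by apply: subset_closure; rewrite /= ux.
Qed.

Let chi c x : R := if x == c then 1 else 0.

Let chi_pos c l : 0 < l <= 1 -> [set x | l <= chi c x] = [set c].
Proof.
move=> /andP[l0 l1]; apply/seteqP; split => x /=; rewrite /chi.
  by case: eqP => // _; rewrite leNgt l0.
by move=> ->; rewrite eqxx.
Qed.

Let chi_level c l : 0 <= l <= 1 -> level (chi c) l = [set c].
Proof.
move=> /andP[l0 l1]; rewrite /level; case: eqVneq => [_|ln0].
  have -> : [set x | 0 < chi c x] = [set c].
    apply/seteqP; split => x /=; rewrite /chi; first by case: eqP => //; rewrite ltxx.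
    by move=> ->; rewrite eqxx.
  by apply: compactR_closure; exact: compact_set1.
by apply: chi_pos; rewrite lt_neqAle eq_sym ln0 l0.
Qed.

Lemma fuzzy_crisp_subproof c : is_fuzzy_number (chi c).
Proof.
split.
- by move=> x; rewrite /chi; case: eqP; rewrite !lexx ler01.
- by exists c; rewrite /chi eqxx.
- apply: usc_superlevel => [x|l l0]; first by rewrite /chi; case: eqP.
  have [l1|l1] := leP l 1.
    rewrite chi_pos ?l0//; exact: (compactR_closed (@compact_set1 _ c)).
  suff -> : [set x | l <= chi c x] = set0 by exact: closed0.
  apply/seteqP; split => x //=; rewrite /chi leNgt => /negP; apply.
  by case: eqP => // _; exact: lt_trans l1.
- move=> x y l l01; rewrite /chi; case: (eqVneq x c) => [->|_]; last first.
    by rewrite ge_min; case: eqP; rewrite ?lexx ?ler01.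
  case: (eqVneq y c) => [->|_]; last first.
    by rewrite ge_min; case: eqP => // _; rewrite ?lexx ?ler01 ?orbT.
  by rewrite -mulrDl addrC subrK mul1r eqxx minxx.
- by rewrite chi_level ?lexx ?ler01//; exact: compact_set1.
Qed.

Definition fuzzy_crisp c : fuzzy_number R := FuzzyNumber (fuzzy_crisp_subproof c).

Lemma level_crisp c l : 0 <= l <= 1 -> level (fuzzy_crisp c) l = [set c].
Proof. exact: chi_level. Qed.

Lemma fuzzy_scale_exists c u : exists w : fuzzy_number R,
  forall l, 0 <= l <= 1 -> level w l = [set c * x | x in level u l].
Proof.
have [->|c0] := eqVneq c 0.
  exists (fuzzy_crisp 0) => l l01; rewrite level_crisp//.
  have [x xl] := level_nonempty u l01.
  apply/seteqP; split => y /=; first by move=> ->; exists x => //; rewrite mul0r.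
  by move=> [? _ <-]; rewrite mul0r.
pose w z := u (c^-1 * z).
have wset (P : set R) : (fun z => P (c^-1 * z)) = [set c * x | x in P].
  apply/seteqP; split => z /=.
    by move=> Pz; exists (c^-1 * z) => //; rewrite mulrA divff// mul1r.
  by move=> [x Px <-]; rewrite mulrA mulVf// mul1r.
have cc (d : R) : continuous (fun z : R => d * z).
  by move=> x; apply: cvgM; [exact: cvg_cst|exact: cvg_id].
have wlev l : 0 <= l <= 1 -> level w l = [set c * x | x in level u l].
  move=> /andP[l0 l1]; rewrite /level; case: ifPn => _; last first.
    by rewrite -wset.
  have -> : [set x | 0 < w x] = [set c * x | x in [set x | 0 < u x]].
    by rewrite -wset.
  apply/seteqP; split.
    have -> : [set c * x | x in closure [set x | 0 < u x]] =
        closure [set c * x | x in closure [set x | 0 < u x]].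
      apply/esym/compactR_closure.
      apply: continuous_compact; first exact: continuous_subspaceT.
      by have := fuzzy_compact (fuzzy_numberP u); rewrite /level eqxx.
    by apply/closureS/image_subset; exact: subset_closure.
  move=> _ [x xu <-] B /(cc c x) cB.
  by have [y [uy By]] := xu _ cB; exists (c * y); split => //; exists y.
have wF : is_fuzzy_number w.
  split.
  - by move=> z; rewrite fuzzy_ge0 fuzzy_le1.
  - have [x ux] := fuzzy_normal (fuzzy_numberP u).
    by exists (c * x); rewrite /w mulrA mulVf// mul1r.
  - apply: usc_superlevel => [x|l l0]; first exact: fuzzy_ge0.
    have -> : [set x | l <= w x] =
      (fun z => c^-1 * z) @^-1` [set x | l <= u x] by [].
    apply: closed_preimage; first exact: cc.
    exact: superlevel_closed (fuzzy_usc (fuzzy_numberP u)).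
  - move=> x y l l01; rewrite /w mulrDr mulrCA [_ * (_ * y)]mulrCA.
    exact: (fuzzy_convex (fuzzy_numberP u)).
  - rewrite wlev ?lexx ?ler01//.
    apply: continuous_compact; first exact: continuous_subspaceT.
    exact: fuzzy_compact (fuzzy_numberP u).
by exists (FuzzyNumber wF).
Qed.

Definition fuzzy_scale c u : fuzzy_number R :=
  sval (cid (fuzzy_scale_exists c u)).

Lemma level_scale c u l : 0 <= l <= 1 ->
  level (fuzzy_scale c u) l = [set c * x | x in level u l].
Proof. by move=> l01; rewrite /fuzzy_scale; case: cid => w /= ->. Qed.

Lemma fuzzy_addA : associative fuzzy_add.
Proof.
move=> u v w; apply: level_inj => l l01; rewrite !level_add//.
apply/seteqP; split => z /=.
  move=> [x xu [_ [y yv [t tw <-]] <-]].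
  by exists (x + y); [exists x => //; exists y|exists t => //; rewrite addrA].
move=> [_ [x xu [y yv <-]] [t tw <-]].
by exists x => //; exists (y + t); [exists y => //; exists t|rewrite addrA].
Qed.

Lemma fuzzy_addC : commutative fuzzy_add.
Proof.
move=> u v; apply: level_inj => l l01; rewrite !level_add//.
by apply/seteqP; split => _ /= [x xu [y yv <-]];
  exists y => //; exists x => //; rewrite addrC.
Qed.

Lemma fuzzy_add0 : left_id (fuzzy_crisp 0) fuzzy_add.
Proof.
move=> u; apply: level_inj => l l01; rewrite level_add// level_crisp//.
apply/seteqP; split => x /=; first by move=> [_ -> [y yu <-]]; rewrite add0r.
by move=> xu; exists 0 => //; exists x => //; rewrite add0r.
Qed.

End levels.

(* Makes [+] and [\sum] on fuzzy numbers the levelwise addition; there is no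
   opposite, and scaling does not distribute over sums of scalars. *)
HB.instance Definition _ (R : realType) :=
  GRing.isNmodule.Build (fuzzy_number R)
    (@fuzzy_addA R) (@fuzzy_addC R) (@fuzzy_add0 R).

Section endograph_metric.
Context {R : realType}.
Implicit Types (u v w : fuzzy_number R) (p q r : R * R).

(* The library's distance on R * R is the maximum one. *)
Definition euclidean_dist p q : R :=
  Num.sqrt ((p.1 - q.1) ^+ 2 + (p.2 - q.2) ^+ 2).

(* For endographs all these sups and infs are those of nonempty bounded sets
   ([endograph_has_inf], [endograph_has_sup]), so no default value is used. *)
Definition hausdorff_dist (T : Type) (d : T -> T -> R) (A B : set T) : R :=
  Num.max (sup [set inf [set d p q | q in B] | p in A])
          (sup [set inf [set d p q | p in A] | q in B]).

Definition endograph (u : R -> R) : set (R * R) :=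
  [set p | 0 <= p.2 <= 1 /\ p.2 <= u p.1].

Definition endograph_dist u v : R :=
  hausdorff_dist euclidean_dist (endograph u) (endograph v).

Let ed_ge0 p q : 0 <= euclidean_dist p q.
Proof. exact: sqrtr_ge0. Qed.

Let ed_sym p q : euclidean_dist p q = euclidean_dist q p.
Proof.
by rewrite /euclidean_dist -(sqrrN (p.1 - _)) -(sqrrN (p.2 - _)) !opprB.
Qed.

Let ed_xx p : euclidean_dist p p = 0.
Proof. by rewrite /euclidean_dist !subrr expr0n /= addr0 sqrtr0. Qed.

Let ed_triangle p q r :
  euclidean_dist p r <= euclidean_dist p q + euclidean_dist q r.
Proof.
rewrite /euclidean_dist.
have -> : p.1 - r.1 = (p.1 - q.1) + (q.1 - r.1) by rewrite addrA subrK.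
have -> : p.2 - r.2 = (p.2 - q.2) + (q.2 - r.2) by rewrite addrA subrK.
move: (p.1 - q.1) (q.1 - r.1) (p.2 - q.2) (q.2 - r.2) => a b c d.
have ac0 : 0 <= a ^+ 2 + c ^+ 2 by rewrite addr_ge0 ?sqr_ge0.
have bd0 : 0 <= b ^+ 2 + d ^+ 2 by rewrite addr_ge0 ?sqr_ge0.
rewrite -(@ler_pXn2r _ 2) ?nnegrE ?addr_ge0 ?sqrtr_ge0//.
rewrite sqr_sqrtr ?addr_ge0 ?sqr_ge0// !sqrrD !sqr_sqrtr// -sqrtrM//.
have cs : a * b + c * d <= Num.sqrt ((a ^+ 2 + c ^+ 2) * (b ^+ 2 + d ^+ 2)).
  apply: (le_trans (ler_norm _)); rewrite -sqrtr_sqr ler_sqrt ?mulr_ge0//.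
  rewrite -subr_ge0.
  have -> : (a ^+ 2 + c ^+ 2) * (b ^+ 2 + d ^+ 2) - (a * b + c * d) ^+ 2 =
    (a * d - b * c) ^+ 2.
    by rewrite !expr2 !mulrDl !mulrDr !mulNr !mulrN; ring.
  exact: sqr_ge0.
move: cs; set s := Num.sqrt _; lra.
Qed.

Let ed_fst p q : `|p.1 - q.1| <= euclidean_dist p q.
Proof.
by rewrite -sqrtr_sqr ler_sqrt ?lerDl ?addr_ge0 ?sqr_ge0.
Qed.

Let ed_snd p q : `|p.2 - q.2| <= euclidean_dist p q.
Proof.
by rewrite -sqrtr_sqr ler_sqrt ?lerDr ?addr_ge0 ?sqr_ge0.
Qed.

Lemma endograph0 u x : endograph u (x, 0).
Proof. by split; rewrite /= ?lexx ?ler01// fuzzy_ge0. Qed.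

Lemma endograph_has_inf u p : has_inf [set euclidean_dist p q | q in endograph u].
Proof.
split; first by exists (euclidean_dist p (0, 0)), (0, 0) => //; exact: endograph0.
by exists 0 => _ [q _ <-].
Qed.

Let einf u p := inf [set euclidean_dist p q | q in endograph u].

Let einf_ge0 u p : 0 <= einf u p.
Proof.
apply: lb_le_inf; first by have [] := endograph_has_inf u p.
by move=> _ [q _ <-].
Qed.

Let einf_le u p q : endograph u q -> einf u p <= euclidean_dist p q.
Proof.
move=> uq; apply: ge_inf; first by have [] := endograph_has_inf u p.
by exists q.
Qed.

Let einf_le1 u v p : endograph u p -> einf v p <= 1.
Proof.
move=> [/andP[p0 p1] _]; apply: le_trans (einf_le p (endograph0 v p.1)) _.
rewrite /euclidean_dist /= subrr subr0 expr0n /= add0r sqrtr_sqr ger0_norm//.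
Qed.

Lemma endograph_has_sup u v : has_sup
  [set inf [set euclidean_dist p q | q in endograph v] | p in endograph u].
Proof.
split; first by exists (einf v (0, 0)), (0, 0) => //; exact: endograph0.
by exists 1 => _ [p up <-]; exact: einf_le1 up.
Qed.

Let endograph_distE u v : endograph_dist u v =
  Num.max (sup [set einf v p | p in endograph u])
          (sup [set einf u p | p in endograph v]).
Proof.
congr Num.max; congr sup; apply: eq_imagel => p _; rewrite /einf.
by congr inf; apply: eq_imagel => q _; rewrite ed_sym.
Qed.

Let dist_leP u v e : endograph_dist u v <= e <->
  (forall p, endograph u p -> einf v p <= e) /\
  (forall p, endograph v p -> einf u p <= e).
Proof.
have H (u1 v1 : fuzzy_number R) :
    (sup [set einf v1 p | p in endograph u1] <= e) <->
    (forall p, endograph u1 p -> einf v1 p <= e).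
  split=> [le_e p up|le_e].
    apply: le_trans le_e; apply: ub_le_sup; last by exists p.
    by have [] := endograph_has_sup u1 v1.
  apply: ge_sup; first by have [] := endograph_has_sup u1 v1.
  by move=> _ [p up <-]; exact: le_e.
rewrite endograph_distE ge_max; split.
  by move=> /andP[/H ? /H].
by move=> [/H -> /H ->].
Qed.

Lemma endograph_dist_le1 u v : endograph_dist u v <= 1.
Proof. by apply/dist_leP; split => p; exact: einf_le1. Qed.

Lemma endograph_dist_sym u v : endograph_dist u v = endograph_dist v u.
Proof. by rewrite !endograph_distE maxC. Qed.

Lemma endograph_distxx u : endograph_dist u u = 0.
Proof.
apply/eqP; rewrite eq_le; apply/andP; split.
  by apply/dist_leP; split => p up; rewrite -(ed_xx p); exact: einf_le.
have /dist_leP[+ _] : endograph_dist u u <= endograph_dist u u by [].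
by move=> /(_ _ (endograph0 u 0)); exact: le_trans.
Qed.

Let dist_approx u v e p : endograph u p -> endograph_dist u v < e ->
  exists2 q, endograph v q & euclidean_dist p q < e.
Proof.
move=> up uve.
have /dist_leP[/(_ _ up) + _] : endograph_dist u v <= endograph_dist u v by [].
move=> /le_lt_trans /(_ uve) /(inf_lt (proj1 (endograph_has_inf v p))).
by move=> [_ [q vq <-] pq]; exists q.
Qed.

Lemma endograph_dist_triangle v u w :
  endograph_dist u w <= endograph_dist u v + endograph_dist v w.
Proof.
have H (u1 v1 w1 : fuzzy_number R) p : endograph u1 p ->
    einf w1 p <= endograph_dist u1 v1 + endograph_dist v1 w1.
  move=> up; apply/ler_addgt0Pl => e e0.
  have e20 : 0 < e / 2 by rewrite divr_gt0.
  have [|q vq pq] := @dist_approx u1 v1 (endograph_dist u1 v1 + e / 2) p up.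
    by rewrite ltrDl.
  have [|r wr qr] := @dist_approx v1 w1 (endograph_dist v1 w1 + e / 2) q vq.
    by rewrite ltrDl.
  apply: le_trans (einf_le p wr) _; apply: le_trans (ed_triangle p q r) _.
  by move: pq qr; lra.
apply/dist_leP; split => p hp; first exact: H hp.
have := H w v u p hp.
by rewrite (endograph_dist_sym w v) (endograph_dist_sym v u) addrC.
Qed.

Lemma endograph_dist_eq0 u v : endograph_dist u v = 0 -> u = v.
Proof.
have H (u1 v1 : fuzzy_number R) x : endograph_dist u1 v1 = 0 -> u1 x <= v1 x.
  move=> uv0; rewrite leNgt; apply/negP => vu.
  pose a := (v1 x + u1 x) / 2.
  have va : v1 x < a by rewrite /a; lra.
  have au : a < u1 x by rewrite /a; lra.
  have /nbhs_ballP[d /= d0 dv] := fuzzy_usc (fuzzy_numberP v1) va.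
  have up : endograph u1 (x, u1 x).
    by split => //=; rewrite fuzzy_ge0 fuzzy_le1.
  have [|q [_ vq] pq] := @dist_approx u1 v1 (Num.min d (u1 x - a)) _ up.
    by rewrite uv0 lt_min d0 subr_gt0.
  move: pq; rewrite lt_min => /andP[pqd pqa].
  have /= := dv q.1 (le_lt_trans (ed_fst _ _) pqd).
  apply/negP; rewrite -leNgt; apply: le_trans vq.
  have := le_lt_trans (ed_snd _ _) pqa => /=.
  by rewrite ltr_norml => /andP[_]; lra.
move=> uv0; apply: fuzzy_ext => x; apply/eqP.
by rewrite eq_le !H// endograph_dist_sym.
Qed.

End endograph_metric.

(* The topology of [fuzzy_number R] is that of the metric [endograph_dist]. *)
HB.instance Definition _ (R : realType) :=
  isMetric.Build R (fuzzy_number R)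
    (@endograph_distxx R) (@endograph_dist_eq0 R) (@endograph_dist_sym R)
    (@endograph_dist_triangle R).

Section operator.
Context {R : realType}.
Implicit Types (a b m x : R) (f : R -> fuzzy_number R).

Record class_A m (sigma : R -> R) : Prop := ClassA {
  class_A_nondecreasing : {homo sigma : x y / x <= y} ;
  class_A_left : forall x, x <= - m -> sigma x = 0 ;
  class_A_right : forall x, m <= x -> sigma x = 1 }.

Definition phi m (sigma : R -> R) x : R := sigma (x + m) - sigma (x - m).

Definition fuzzy_operator a b m (sigma : R -> R) (n : nat) f x
    : fuzzy_number R :=
  let h := (b - a) / n%:R in
  let node k := a + k%:R * h in
  \sum_(k < n.+1) fuzzy_scale (phi m sigma (2 * m / h * (x - node k)))
                              (f (node k)).

(* The set is bounded above by 1 ([endograph_dist_le1]), and it is nonempty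
   when a <= b and 0 < delta. *)
Definition fuzzy_modulus a b f (delta : R) : R :=
  sup [set endograph_dist (f p.1) (f p.2) | p in
        [set p : R * R | [/\ p.1 \in `[a, b], p.2 \in `[a, b]
                           & `|p.1 - p.2| < delta]]].

End operator.

(* Main.v *)
Require Import Defs.
From mathcomp Require Import all_boot all_order all_algebra.
From mathcomp Require Import all_classical all_reals all_analysis.
From mathcomp Require Import ring lra.

Import Order.TTheory GRing.Theory Num.Theory.
Import numFieldNormedType.Exports.

Local Open Scope classical_set_scope.
Local Open Scope ring_scope.

(** The kernel [phi] vanishes outside [-2m, 2m], so at a point [x] of the cell
    [x_i, x_(i+1)] only the terms [i] and [i+1] of the operator survive; since
    [sigma] is 0 left of [-m] and 1 right of [m], their coefficients are
    [1 - s] and [s] with [s = sigma (2m/h (x - x_i) - m)] in [0, 1]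
    ([phi_left_node], [phi_right_node], [fuzzy_operator_cell]).  The operator
    is therefore a levelwise convex combination of [f x_i] and [f x_(i+1)].
    Inside the cell both nodes are at distance less than the step [h] from [x],
    so both values lie within the modulus [e] of [f x]; at a node [s] is 0 or 1
    and the operator interpolates.

    It remains to see that a convex combination of two fuzzy numbers within [e]
    of [w] is within [sqrt 2 * e] of [w] ([endograph_dist_mix]).  Matching
    points of the endographs of [u] and [v] to points of that of [w], and
    combining them (abscissas by the convex combination, ordinates by the
    minimum), displaces each of the two coordinates by at most [e]; the
    factor [sqrt 2] is the Euclidean norm of [(1, 1)]. *)

(** * Endographs of convex combinations *)

Section endograph_mix.
Context {R : realType}.
Implicit Types (u v w : fuzzy_number R) (p q : R * R) (e s x y z : R).

Lemma euclidean_dist_sym p q : euclidean_dist p q = euclidean_dist q p.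
Proof.
by rewrite /euclidean_dist -(sqrrN (p.1 - _)) -(sqrrN (p.2 - _)) !opprB.
Qed.

Lemma norm_fst_le_euclidean p q : `|p.1 - q.1| <= euclidean_dist p q.
Proof. by rewrite -sqrtr_sqr ler_sqrt ?lerDl ?addr_ge0 ?sqr_ge0. Qed.

Lemma norm_snd_le_euclidean p q : `|p.2 - q.2| <= euclidean_dist p q.
Proof. by rewrite -sqrtr_sqr ler_sqrt ?lerDr ?addr_ge0 ?sqr_ge0. Qed.

Lemma euclidean_dist_le_sqrt2 p q e : 0 <= e ->
  `|p.1 - q.1| <= e -> `|p.2 - q.2| <= e -> euclidean_dist p q <= Num.sqrt 2 * e.
Proof.
move=> e0 h1 h2.
rewrite -[in leRHS](ger0_norm e0) -sqrtr_sqr -sqrtrM// /euclidean_dist.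
rewrite ler_sqrt ?mulr_ge0 ?sqr_ge0//.
have sq c : `|c| <= e -> c ^+ 2 <= e ^+ 2.
  by move=> ce; rewrite -real_normK ?num_real// lerXn2r ?nnegrE.
by have := sq _ h1; have := sq _ h2; lra.
Qed.

Lemma endograph_approx u v e p : endograph u p -> endograph_dist u v < e ->
  exists2 q, endograph v q & euclidean_dist p q < e.
Proof.
move=> up; rewrite /endograph_dist /hausdorff_dist gt_max => /andP[uve _].
have le_sup : inf [set euclidean_dist p q | q in endograph v] <=
    sup [set inf [set euclidean_dist p q | q in endograph v]
          | p in endograph u].
  apply: ub_le_sup; last by exists p.
  by have [] := endograph_has_sup u v.
have := inf_lt (proj1 (endograph_has_inf v p)) (le_lt_trans le_sup uve).
by move=> [_ [q vq <-] pq]; exists q.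
Qed.

(** The second half of the Hausdorff distance is the first one with the two
    sets exchanged, by symmetry of the Euclidean distance. *)
Lemma endograph_dist_le u v e :
  (forall p, endograph u p -> exists2 q, endograph v q & euclidean_dist p q <= e) ->
  (forall p, endograph v p -> exists2 q, endograph u q & euclidean_dist p q <= e) ->
  endograph_dist u v <= e.
Proof.
have half (u1 v1 : fuzzy_number R) :
    (forall p, endograph u1 p ->
      exists2 q, endograph v1 q & euclidean_dist p q <= e) ->
    sup [set inf [set euclidean_dist p q | q in endograph v1]
          | p in endograph u1] <= e.
  move=> H; apply: ge_sup; first by have [] := endograph_has_sup u1 v1.
  move=> _ [p up <-]; have [q vq pq] := H p up.
  apply: le_trans pq; apply: ge_inf; last by exists q.
  by have [] := endograph_has_inf v1 p.
move=> uv vu; rewrite /endograph_dist /hausdorff_dist ge_max half//=.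
have -> : [set inf [set euclidean_dist p q | p in endograph u]
            | q in endograph v] =
    [set inf [set euclidean_dist p q | q in endograph u] | p in endograph v].
  apply: eq_imagel => q _; congr inf.
  by apply: eq_imagel => p _; rewrite euclidean_dist_sym.
exact: half.
Qed.

Definition fuzzy_mix s u v : fuzzy_number R :=
  fuzzy_scale (1 - s) u + fuzzy_scale s v.

(** For positive [l] the superlevel set is the level set itself, with no closure
    taken; ordinate 0 is treated apart wherever this is used. *)
Lemma fuzzy_mix_levelE s u v l : 0 < l <= 1 ->
  [set z | l <= fuzzy_mix s u v z] =
  [set (1 - s) * x + s * y | x in [set x | l <= u x] & y in [set y | l <= v y]].
Proof.
move=> /andP[l0 l1]; have l01 : 0 <= l <= 1 by rewrite ltW.
rewrite -level_pos// [fuzzy_mix _ _ _]/(fuzzy_add _ _) level_add// !level_scale//.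
rewrite !level_pos//; apply/seteqP; split => z.
  by move=> [_ [x xu <-] [_ [y yv <-] <-]]; exists x => //; exists y.
move=> [x xu [y yv <-]]; exists ((1 - s) * x); first by exists x.
by exists (s * y) => //; exists y.
Qed.

Lemma fuzzy_scale0 u : fuzzy_scale 0 u = 0.
Proof.
apply: level_inj => l l01; rewrite level_scale// (level_crisp 0)//.
have [x xl] := level_nonempty u l01.
apply/seteqP; split => y /=; first by move=> [? _ <-]; rewrite mul0r.
by move=> ->; exists x => //; rewrite mul0r.
Qed.

Lemma fuzzy_scale1 u : fuzzy_scale 1 u = u.
Proof.
apply: level_inj => l l01; rewrite level_scale//.
apply/seteqP; split => y /=; first by move=> [x xu <-]; rewrite mul1r.
by move=> yu; exists y => //; rewrite mul1r.
Qed.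

Lemma fuzzy_mix0 u v : fuzzy_mix 0 u v = u.
Proof. by rewrite /fuzzy_mix subr0 fuzzy_scale1 fuzzy_scale0 addr0. Qed.

Lemma fuzzy_mix1 u v : fuzzy_mix 1 u v = v.
Proof. by rewrite /fuzzy_mix subrr fuzzy_scale1 fuzzy_scale0 add0r. Qed.

Lemma norm_mix_le s x y z e : 0 <= s <= 1 -> `|z - x| <= e -> `|z - y| <= e ->
  `|z - ((1 - s) * x + s * y)| <= e.
Proof.
move=> /andP[s0 s1] zx zy.
have -> : z - ((1 - s) * x + s * y) = (1 - s) * (z - x) + s * (z - y) by ring.
apply: le_trans (ler_normD _ _) _; rewrite !normrM (ger0_norm s0).
rewrite ger0_norm ?subr_ge0//.
have : (1 - s) * `|z - x| <= (1 - s) * e by rewrite ler_wpM2l ?subr_ge0.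
have : s * `|z - y| <= s * e by rewrite ler_wpM2l.
by lra.
Qed.

Lemma norm_min_le x y z e : `|z - x| <= e -> `|z - y| <= e ->
  `|z - Num.min x y| <= e.
Proof. by rewrite /Num.min; case: ifP. Qed.

Lemma endograph_mix s u v p q : endograph u p -> endograph v q ->
  endograph (fuzzy_mix s u v) ((1 - s) * p.1 + s * q.1, Num.min p.2 q.2).
Proof.
move=> [/andP[p0 p1] pu] [/andP[q0 q1] qv].
have min1 : Num.min p.2 q.2 <= 1 by rewrite ge_min p1.
have min0 : 0 <= Num.min p.2 q.2 by rewrite le_min p0.
split; rewrite /= ?min0//.
have [le0|gt0] := leP (Num.min p.2 q.2) 0.
  exact: le_trans le0 (fuzzy_ge0 _ _).
have /seteqP[_] := fuzzy_mix_levelE s u v _ (introT andP (conj gt0 min1)).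
apply; exists p.1 => /=; first by rewrite ge_min pu.
by exists q.1 => //=; rewrite ge_min qv orbT.
Qed.

(** The quasi-concavity of [w] makes the same combination stay in the endograph
    of a single fuzzy number. *)
Lemma endograph_convex w s p q : 0 <= s <= 1 -> endograph w p -> endograph w q ->
  endograph w ((1 - s) * p.1 + s * q.1, Num.min p.2 q.2).
Proof.
move=> /andP[s0 s1] [/andP[p0 p1] pw] [/andP[q0 q1] qw].
split; first by rewrite /= le_min ge_min p0 q0 p1.
have s'01 : 0 <= 1 - s <= 1 by lra.
have := fuzzy_convex (fuzzy_numberP w) p.1 q.1 s'01.
rewrite subKr => /(le_trans _); apply.
by rewrite le_min !ge_min pw qw orbT.
Qed.

(** Both inclusions combine two matched points; the bound is first obtained
    for every [e' > e] because the infima defining the distance are only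
    approached. *)
Lemma endograph_dist_mix s u v w e : 0 <= s <= 1 -> 0 <= e ->
  endograph_dist u w <= e -> endograph_dist v w <= e ->
  endograph_dist (fuzzy_mix s u v) w <= Num.sqrt 2 * e.
Proof.
move=> s01 e0 uw vw.
have sqrt2_gt0 : 0 < Num.sqrt 2 :> R by rewrite sqrtr_gt0.
rewrite mulrC -ler_pdivrMr//; apply/ler_addgt0Pl => d d0.
rewrite ler_pdivrMr// mulrC addrC.
have uwe : endograph_dist u w < e + d by apply: le_lt_trans uw _; rewrite ltrDl.
have vwe : endograph_dist v w < e + d by apply: le_lt_trans vw _; rewrite ltrDl.
have e'0 : 0 <= e + d by rewrite addr_ge0// ltW.
have close p q : euclidean_dist p q < e + d ->
    `|p.1 - q.1| <= e + d /\ `|p.2 - q.2| <= e + d.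
  move=> /ltW pq; split; apply: le_trans pq.
    exact: norm_fst_le_euclidean.
  exact: norm_snd_le_euclidean.
apply: endograph_dist_le => [[z l] [/= /andP[l0 l1] lz]|p wp].
  move: l0; rewrite le_eqVlt => /predU1P[l0|l0].
    exists (z, 0); first exact: endograph0.
    by rewrite /euclidean_dist -l0 !subrr expr0n /= addr0 sqrtr0 mulr_ge0// ltW.
  have l01 : 0 < l <= 1 by rewrite l0.
  have /seteqP[+ _] := fuzzy_mix_levelE s u v _ l01.
  move=> /(_ z lz) /= [x lx [y ly <-]].
  have ux : endograph u (x, l) by split; rewrite //= ltW.
  have vy : endograph v (y, l) by split; rewrite //= ltW.
  have [p wp /close[/= p1 p2]] := endograph_approx _ _ _ _ ux uwe.
  have [q wq /close[/= q1 q2]] := endograph_approx _ _ _ _ vy vwe.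
  exists ((1 - s) * p.1 + s * q.1, Num.min p.2 q.2).
    exact: endograph_convex.
  apply: euclidean_dist_le_sqrt2 => //=; last exact: norm_min_le.
  have -> : (1 - s) * x + s * y - ((1 - s) * p.1 + s * q.1) =
    - (0 - ((1 - s) * (x - p.1) + s * (y - q.1))) by ring.
  by rewrite normrN; apply: norm_mix_le => //; rewrite sub0r normrN.
rewrite endograph_dist_sym in uwe; rewrite endograph_dist_sym in vwe.
have [q uq /close[q1 q2]] := endograph_approx _ _ _ _ wp uwe.
have [r vr /close[r1 r2]] := endograph_approx _ _ _ _ wp vwe.
exists ((1 - s) * q.1 + s * r.1, Num.min q.2 r.2); first exact: endograph_mix.
by apply: euclidean_dist_le_sqrt2 => //=; [exact: norm_mix_le|exact: norm_min_le].
Qed.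

End endograph_mix.

(** * The operator on one cell of the grid *)

Section operator_cell.
Context {R : realType}.
Implicit Types (a b m x t : R) (sigma : R -> R) (f : R -> fuzzy_number R).

Lemma class_A_01 m sigma t : class_A m sigma -> 0 <= sigma t <= 1.
Proof.
move=> sA; apply/andP; split.
  have [tm|/ltW mt] := leP t (- m); first by rewrite (class_A_left sA).
  by rewrite -(class_A_left sA (lexx (- m))) (class_A_nondecreasing sA).
have [mt|/ltW tm] := leP m t; first by rewrite (class_A_right sA).
by rewrite -(class_A_right sA (lexx m)) (class_A_nondecreasing sA).
Qed.

Lemma phi_outside m sigma t : 0 < m -> class_A m sigma ->
  2 * m <= `|t| -> phi m sigma t = 0.
Proof.
move=> m0 sA; rewrite /phi ler_normr => /orP[] t2.
  have [tm tm'] : m <= t - m /\ m <= t + m by split; lra.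
  by rewrite !(class_A_right sA)// subrr.
have [tm tm'] : t - m <= - m /\ t + m <= - m by split; lra.
by rewrite !(class_A_left sA)// subrr.
Qed.

Lemma phi_left_node m sigma t : class_A m sigma ->
  0 <= t -> phi m sigma t = 1 - sigma (t - m).
Proof.
by move=> sA t0; rewrite /phi (class_A_right sA (x := t + m))//; lra.
Qed.

Lemma phi_right_node m sigma t : class_A m sigma ->
  t <= 2 * m -> phi m sigma (t - 2 * m) = sigma (t - m).
Proof.
move=> sA t2; rewrite /phi (class_A_left sA (x := t - 2 * m - m)) ?subr0.
  by congr sigma; ring.
by lra.
Qed.

(** The arguments of the kernel at consecutive nodes differ by exactly [2m], the
    half-width of its support: all nodes but the two ends of the cell fall
    outside, and at those two ends one of the two shifted copies of [sigma] is
    already constant, so the coefficients add up to 1. *)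
Lemma fuzzy_operator_cell a b m sigma n f i x :
  a < b -> 0 < m -> class_A m sigma -> (i < n)%N ->
  let h := (b - a) / n%:R in
  a + i%:R * h <= x <= a + i.+1%:R * h ->
  fuzzy_operator a b m sigma n f x =
  fuzzy_mix (sigma (2 * m / h * (x - (a + i%:R * h)) - m))
    (f (a + i%:R * h)) (f (a + i.+1%:R * h)).
Proof.
move=> ab m0 sA ltin h /andP[xi xi1]; rewrite /fuzzy_operator -/h.
have h0 : 0 < h by rewrite divr_gt0 ?subr_gt0// ltr0n (leq_trans _ ltin).
have c0 : 0 < 2 * m / h by rewrite divr_gt0// mulr_gt0.
have ch : 2 * m / h * h = 2 * m by rewrite divfK ?gt_eqF.
have lti : (i < n.+1)%N by rewrite ltnS ltnW.
have lti1 : (i.+1 < n.+1)%N by rewrite ltnS.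
rewrite (bigD1 (Ordinal lti))//= (bigD1 (Ordinal lti1))/=; last first.
  by rewrite -val_eqE /= eqn_leq ltnn.
rewrite big1 ?addr0 => [|k /andP[ki ki1]].
  have -> : 2 * m / h * (x - (a + i.+1%:R * h)) =
      2 * m / h * (x - (a + i%:R * h)) - 2 * m.
    by move: ch; generalize (2 * m / h) => c <-; rewrite -(natr1 i); ring.
  rewrite phi_left_node ?phi_right_node//.
    rewrite -[leRHS]ch ler_pM2l//.
    by move: xi1; rewrite -(natr1 i); lra.
  by rewrite mulr_ge0 ?(ltW c0)// subr_ge0.
rewrite phi_outside ?fuzzy_scale0//.
rewrite normrM (gtr0_norm c0) -[leLHS]ch ler_pM2l// ler_normr.
have node_le j j' : (j <= j')%N -> j%:R * h <= j'%:R * h.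
  by move=> jj'; rewrite ler_pM2r// ler_nat.
have [lt_ki|lt_ik|eq_ki] := ltngtP k i.
- by move: (node_le _ _ lt_ki); rewrite -(natr1 k) => ?; apply/orP; left; lra.
- have lt_i1k : (i.+1 < k)%N.
    by rewrite ltn_neqAle lt_ik andbT eq_sym; exact: ki1.
  move: (node_le _ _ lt_i1k) xi1; rewrite -(natr1 i.+1) => ? ?.
  by apply/orP; right; lra.
- by move: ki; rewrite -val_eqE /= eq_ki eqxx.
Qed.

Lemma exists_cell a b n x : (0 < n)%N -> a <= x <= b ->
  let h := (b - a) / n%:R in
  exists2 i, (i < n)%N & a + i%:R * h <= x <= a + i.+1%:R * h.
Proof.
move=> n0 /andP[ax xb] h.
have [k kn] : exists k, n = k.+1 by exists n.-1; rewrite prednK.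
have ex : exists i, x <= a + i.+1%:R * h.
  by exists k; rewrite -kn mulrC divfK ?pnatr_eq0 -?lt0n// addrC subrK.
case: (ex_minnP ex) => -[|i] xi min_i.
  by exists 0%N => //; rewrite mul0r addr0 ax.
exists i.+1.
  rewrite kn ltnS; apply: min_i.
  by rewrite -kn mulrC divfK ?pnatr_eq0 -?lt0n// addrC subrK.
rewrite xi andbT leNgt; apply/negP => /ltW /min_i.
by rewrite ltnn.
Qed.

End operator_cell.

Lemma endograph_dist_le_modulus (R : realType) (a b d x y : R) f :
  x \in `[a, b] -> y \in `[a, b] -> `|x - y| < d ->
  endograph_dist (f x) (f y) <= fuzzy_modulus a b f d.
Proof.
move=> xab yab xy; apply: ub_le_sup; last by exists (x, y).
by exists 1 => _ [p _ <-]; exact: endograph_dist_le1.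
Qed.

Theorem theorem5p7 (R : realType) (a b m : R) (sigma : R -> R)
    (f0 : R -> fuzzy_number R) :
  a < b -> 0 < m -> class_A m sigma ->
  {within `[a, b], continuous f0} ->
  forall n : nat, (1 <= n)%N ->
  sup [set endograph_dist (fuzzy_operator a b m sigma n f0 x) (f0 x)
        | x in `[a, b]]
    <= Num.sqrt 2 * fuzzy_modulus a b f0 ((b - a) / n%:R).
Proof.
move=> ab m0 sA _ n n0; set h := (b - a) / n%:R.
have h0 : 0 < h by rewrite divr_gt0 ?subr_gt0// ltr0n.
have nh : n%:R * h = b - a by rewrite mulrC divfK ?pnatr_eq0 -?lt0n.
have aab : a \in `[a, b] by rewrite in_itv/= lexx ltW.
apply: ge_sup.
  by exists (endograph_dist (fuzzy_operator a b m sigma n f0 a) (f0 a)), a.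
move=> _ [x /= xab <-].
have omega_ge0 : 0 <= fuzzy_modulus a b f0 h.
  rewrite -(endograph_distxx (f0 a)).
  by apply: endograph_dist_le_modulus; rewrite ?subrr ?normr0.
have [i ltin xi] := exists_cell _ _ _ _ n0 xab.
rewrite -/h in xi.
rewrite (fuzzy_operator_cell _ _ _ _ _ f0 _ _ ab m0 sA ltin xi) -/h.
have node_in j : (j <= n)%N -> a + j%:R * h \in `[a, b].
  move=> jn; rewrite in_itv/= lerDl mulr_ge0 ?(ltW h0)//=.
  have : j%:R * h <= n%:R * h by rewrite ler_pM2r// ler_nat.
  by rewrite nh; lra.
have dist0 w : endograph_dist w w <= Num.sqrt 2 * fuzzy_modulus a b f0 h.
  by rewrite endograph_distxx mulr_ge0.
(* The modulus only controls pairs at distance strictly less than [h], hence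
   the two ends of the cell are treated apart. *)
have [xE|x_neq] := eqVneq x (a + i%:R * h).
  by rewrite -xE subrr mulr0 sub0r (class_A_left sA)// fuzzy_mix0.
have i1E : a + i.+1%:R * h = a + i%:R * h + h by rewrite -(natr1 i); ring.
have [xE|x_neq'] := eqVneq x (a + i.+1%:R * h).
  rewrite (class_A_right sA) ?fuzzy_mix1 -?xE//.
  have -> : x - (a + i%:R * h) = h by rewrite xE i1E; ring.
  by rewrite divfK ?gt_eqF//; lra.
have {xi x_neq x_neq'} /andP[lt_ix lt_xi1] :
    a + i%:R * h < x < a + i%:R * h + h.
  by rewrite -i1E !lt_neqAle x_neq' [_ == x]eq_sym x_neq.
apply: endograph_dist_mix => //; first exact: class_A_01 sA.
  apply: endograph_dist_le_modulus => //; first exact/node_in/ltnW.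
  by rewrite ltr_norml; lra.
apply: endograph_dist_le_modulus => //; first exact: node_in.
by rewrite i1E ltr_norml; lra.
Qed.
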